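(* Let $\mathbf a$ be the truthful profile of $n\ge 2$ voters participating in $CUD(\mathcal F^{IMaj}_\sigma,\tau)$ with $\frac n2<\sigma\le n$. Assume that the additive Price of Anarchy $PoA^+(\mathbf a)$ is well defined for this instance (i.e. at least one valid alternative can become the winner). Then: 1. if $\tau\le\sigma-\left\lfloor\frac n2\right\rfloor$, then $PoA^+(\mathbf a)=0$; 2. if $\sigma-\left\lfloor\frac n2\right\rfloor<\tau<\sigma$, then $PoA^+(\mathbf a)\le\left\lfloor\frac n2\right\rfloor+\tau-\sigma$; 3. if $\tau\ge\sigma$, then $PoA^+(\mathbf a)\le\left\lfloor\frac n2\right\rfloor-1$.
   Context: Setting (Consensus Under a Deadline, CUD). $V=\{1,\dots,n\}$ is a finite set of $n$ voters, $C$ is a finite set of $m+1$ alternatives containing a default alternative $\psi$; $C^+=C\setminus\{\psi\}$ is the set of valid alternatives ($|C^+|=m\ge 1$). Each voter $i$ has a truthful preference $a_i$, a strict linear order on $C$; $a_i(c,c')$ means that $i$ prefers $c$ to $c'$. It is assumed that $a_i(c,\psi)$ for all $i\in V$, $c\in C^+$. For nonempty $W\subseteq C$, $\mathrm{top}_i(W)$ is the $a_i$-best element of $W$. The deadline $\tau$ is a nonnegative integer and the threshold $\sigma$ is an integer with $\frac n2<\sigma\le n$. Time $t$ counts the remaining steps, running down from $\tau$ to $0$. Scores. For a ballot profile $b^t=(b^t_1,\dots,b^t_n)\in C^n$, $s^t_c=|\{i\in V: b^t_i=c\}|$, and $s^t=(s^t_c)_{c\in C^+}$ is the score vector. For a score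 vector $s$ and $c\in C$, $s+c$ (resp. $s-c$) is $s$ with the score of $c$ increased (resp. decreased) by 1. Possible winners and voting rule. $\widehat W(s,t)=\{c\in C^+ : \sigma-s_c<t+1\}$ is the set of possible winners. $\mathcal F(s,t)=\mathcal F^{IMaj}_\sigma(s,t)$ equals $\{\psi\}$ if $\widehat W(s,t)=\emptyset$ and equals $\widehat W(s,t)$ otherwise. Utilities. Each voter has a utility $u_i(s,t)\in\mathbb R$ on score vectors $s$ and times $t\in\{0,\dots,\tau\}$. With $w=\mathrm{top}_i(\mathcal F(s,t))$ and $w'=\mathrm{top}_i(\mathcal F(s',t))$: $u_i$ is lazy consistent if for all $s,s',t$: $u_i(s,t)>u_i(s',t)\iff a_i(w,w')$; $u_i$ is proactive consistent if for all $s,s',t$: $u_i(s,t)>u_i(s',t)\iff a_i(w,w')$ or ($w=w'$ and $s_w>s'_w$), where for $w=w'=\psi$ neither side is strictly better. Either all voters are lazy consistent or all are proactive consistent. Process. Initially $t=\tau$ and $b^\tau_i=\mathrm{top}_i(C)$ for all $i$. At time $t$: if $\mathcal F(s^t,t)=\{w\}$ is a singleton, the process stops and $w$ is the outcome (the winner if $w\in C^+$; the default if $w=\psi$). Otherwise each voter $i$ computes a best response $w_i\in\arg\max_{c\in C}u_i(s^t-b^t_i+c,\,t-1)$, where $w_i=b_i^t$ if $b_i^t$ is itself a maximizer (a voter changes only for a strict improvement), and otherwise ties among maximizers are broken by $a_i$ (the $a_i$-best maximizer is chosen). Let $I=\{i: w_i\ne b^t_i\}$. If $I\neq\emptyset$,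 one $j\in I$ is chosen uniformly at random and $b^{t-1}_j=w_j$, $b^{t-1}_i=b^t_i$ for $i\ne j$; if $I=\emptyset$, $b^{t-1}=b^t$. Then $t$ is replaced by $t-1$. At $t=0$ the set $\mathcal F(s^0,0)$ is always a singleton because $\sigma>n/2$. A run is any realization of the random choices. Additive Price of Anarchy. Let $b_i=\mathrm{top}_i(C)$ and $s_c=|\{i\in V:b_i=c\}|$ be the scores under truthful ballots. Let $\widehat C\subseteq C^+$ be the set of valid alternatives that are the winner in at least one run of the CUD with truthful profile $\mathbf a$. If $\widehat C\ne\emptyset$, $PoA^+(\mathbf a)=\max_{c\in C}s_c-\min_{c\in\widehat C}s_c$; it is well defined only when $\widehat C\neq\emptyset$. *)

(* Defs.v *)
From HB Require Import structures.
From mathcomp Require Import all_boot all_order all_algebra.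
From mathcomp Require Import boolp reals.

Set Implicit Arguments.
Unset Strict Implicit.
Unset Printing Implicit Defensive.

Import Order.TTheory GRing.Theory Num.Theory.

(* Voters are 'I_n.  A is the set of valid alternatives; the set of all
   alternatives is option A, with None the default alternative psi. *)

Definition strict_linear_order (T : eqType) (r : rel T) : Prop :=
  [/\ irreflexive r, transitive r & forall x y, x != y -> r x y || r y x].

(* The r-best element of W; None is a dummy value when W is empty. *)
Definition top (A : finType) (r : rel (option A)) (W : {set option A}) :
    option A :=
  odflt None [pick c in W | [forall c' in W, (c' != c) ==> r c c']].

Definition ballots (n : nat) (A : finType) := {ffun 'I_n -> option A}.

Definition score (n : nat) (A : finType) (b : ballots n A) (c : option A) : nat :=
  #|[set i | b i == c]|.

(* Score vectors are indexed by valid alternatives only, so adding or removing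
   a vote for None leaves them unchanged. *)
Definition scores (A : finType) := {ffun A -> nat}.

Definition score_vector (n : nat) (A : finType) (b : ballots n A) : scores A :=
  [ffun x => score b (Some x)].

Definition add_vote (A : finType) (s : scores A) (c : option A) : scores A :=
  [ffun x => s x + (Some x == c)].

Definition sub_vote (A : finType) (s : scores A) (c : option A) : scores A :=
  [ffun x => s x - (Some x == c)].

(* The subtraction is truncated, which is harmless since t + 1 > 0. *)
Definition possible_winners (A : finType) (sigma : nat) (s : scores A)
    (t : nat) : {set option A} :=
  [set Some x | x : A & sigma - s x < t + 1].

Definition iterative_majority (A : finType) (sigma : nat) (s : scores A)
    (t : nat) : {set option A} :=
  let W := possible_winners sigma s t in
  if W == set0 then [set None] else W.

Definition utility (R : realType) (A : finType) := scores A -> nat -> R.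

(* Both consistency conditions compare score vectors of ballot profiles of the
   n voters, at times not exceeding the deadline. *)
Definition lazy_consistent (R : realType) (n : nat) (A : finType)
    (sigma tau : nat) (r : rel (option A)) (u : utility R A) : Prop :=
  forall (b b' : ballots n A) (t : nat), t <= tau ->
    let s := score_vector b in
    let s' := score_vector b' in
    let w := top r (iterative_majority sigma s t) in
    let w' := top r (iterative_majority sigma s' t) in
    (u s' t < u s t)%R <-> r w w'.

Definition proactive_consistent (R : realType) (n : nat) (A : finType)
    (sigma tau : nat) (r : rel (option A)) (u : utility R A) : Prop :=
  forall (b b' : ballots n A) (t : nat), t <= tau ->
    let s := score_vector b in
    let s' := score_vector b' in
    let w := top r (iterative_majority sigma s t) in
    let w' := top r (iterative_majority sigma s' t) in
    (u s' t < u s t)%R <->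
      (r w w' \/ exists x : A, [/\ w = Some x, w' = Some x & s' x < s x]).

Section Process.

Variables (R : realType) (n : nat) (A : finType) (sigma : nat).
Variables (a : 'I_n -> rel (option A)) (u : 'I_n -> utility R A).

Definition truthful : ballots n A := [ffun i => top (a i) setT].

Definition maximizers (t : nat) (b : ballots n A) (i : 'I_n) :
    {set option A} :=
  let v c := u i (add_vote (sub_vote (score_vector b) (b i)) c) (t - 1) in
  [set c | [forall c', (v c' <= v c)%R]].

Definition best_response (t : nat) (b : ballots n A) (i : 'I_n) : option A :=
  let M := maximizers t b i in
  if b i \in M then b i else top (a i) M.

Definition movers (t : nat) (b : ballots n A) : {set 'I_n} :=
  [set i | best_response t b i != b i].

(* b' is a possible ballot profile at time t - 1 when b is the one at time t;
   every mover is selected with positive probability. *)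
Definition transition (t : nat) (b b' : ballots n A) : Prop :=
  if movers t b == set0 then b' = b
  else exists2 j, j \in movers t b
       & b' = [ffun i => if i == j then best_response t b j else b i].

(* run t b w: some run that has ballot profile b at time t ends with outcome w. *)
Inductive run : nat -> ballots n A -> option A -> Prop :=
| run_stop t b w :
    iterative_majority sigma (score_vector b) t = [set w] -> run t b w
| run_step t b b' w :
    #|iterative_majority sigma (score_vector b) t.+1| != 1 ->
    transition t.+1 b b' -> run t b' w -> run t.+1 b w.

Definition winners (tau : nat) : {set A} :=
  [set c | `[< run tau truthful (Some c) >]].

(* n is neutral for the minimum, as no score exceeds n; the value is meaningful
   only when winners tau is nonempty. *)
Definition PoA (tau : nat) : int :=
  (\max_(c : option A) score truthful c)%:Z
  - (\big[minn/n]_(c in winners tau) score truthful (Some c))%:Z.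

End Process.

(* Main.v *)
Require Import Defs.
From HB Require Import structures.
From mathcomp Require Import all_boot all_order all_algebra.
From mathcomp Require Import boolp reals.
From mathcomp Require Import zify.

Set Implicit Arguments.
Unset Strict Implicit.
Unset Printing Implicit Defensive.

Import Order.TTheory.

(** A voter whose ballot is her favourite alternative never moves while that
    alternative remains possible at the next step.  Scores change by at most 1
    per step, so a winner w is possible from the start: sigma <= s_w + tau.
    If some x has a strict truthful majority, its supporters never leave: were x
    about to drop out, everything trailing x would already be impossible and the
    process would have stopped.  Hence x is the only possible winner.  Otherwise
    the maximal score is at most n/2, and sigma - tau <= s_w gives the first two
    bounds.  For the third, nobody moves while t >= sigma, so w has a truthful
    vote when t = sigma - 1. *)

(** * Favourite elements of a strict linear order *)

Section TopAlternative.

Variables (A : finType) (r : rel (option A)).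
Hypothesis r_order : strict_linear_order r.

Lemma order_asym x y : r x y -> r y x -> False.
Proof.
by case: r_order => irr tr _ xy yx; have := tr _ _ _ xy yx; rewrite irr.
Qed.

Lemma top_eq (W : {set option A}) c :
  c \in W -> (forall d, d \in W -> d != c -> r c d) -> top r W = c.
Proof.
move=> cW cmax; rewrite /top; case: pickP => [d /andP[dW /forall_inP dmax] | /(_ c)] /=.
  apply/eqP/negPn/negP => dc; apply: (@order_asym c d); first exact: cmax.
  by apply: (implyP (dmax c cW)); rewrite eq_sym.
by rewrite cW /=; case/forall_inP => d dW; apply/implyP/cmax.
Qed.

Lemma top_setT_max c : c != top r setT -> r (top r setT) c.
Proof.
have [irr tr tot] := r_order.
(* The greatest element is one that beats the most others: if [d] beat [e], transitivity would place
   below [d] everything that [e] beats, and [e] as well. *)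
pose m := [arg max_(d > None) #|[set y | r d y]|].
have mmax d : d != m -> r m d.
  rewrite /m; case: arg_maxnP => // e _ emax de.
  have /orP[rde|//] := tot _ _ de.
  suff : #|[set y | r e y]| < #|[set y | r d y]|.
    by rewrite ltnNge; case/negP; exact: emax.
  apply/proper_card/properP; split.
    by apply/subsetP => y; rewrite !inE; exact: tr rde.
  by exists e; rewrite !inE ?irr.
have -> : top r setT = m by apply: top_eq => [|d _]; [rewrite inE | exact: mmax].
exact: mmax.
Qed.

Lemma top_setT_valid : 0 < #|A| -> (forall c : A, r (Some c) None) ->
  exists x, top r setT = Some x.
Proof.
move=> /card_gt0P[c _] cmax; case E: (top r setT) => [x|]; first by exists x.
have := @top_setT_max (Some c); rewrite E => /(_ isT) h.
by case: (order_asym h (cmax c)).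
Qed.

Lemma top_eq_setT (W : {set option A}) : top r setT \in W -> top r W = top r setT.
Proof. by move=> tW; apply: top_eq => // d _; exact: top_setT_max. Qed.

End TopAlternative.

(** * Scores and possible winners when one ballot changes *)

Section Scores.

Variables (n : nat) (A : finType).
Implicit Types b : ballots n A.

Lemma score_disjoint b (c d : option A) : c != d -> score b c + score b d <= n.
Proof.
move=> cd; rewrite /score -cardsUI.
have -> : [set i | b i == c] :&: [set i | b i == d] = set0.
  by apply/setP => i; rewrite !inE; apply/andP => -[/eqP -> /eqP E]; rewrite E eqxx in cd.
by rewrite cards0 addn0 -[X in _ <= X]card_ord; exact: max_card.
Qed.

Lemma score_le b c : score b c <= n.
Proof. by rewrite -[X in _ <= X]card_ord; exact: max_card. Qed.

Definition update b (i : 'I_n) (c : option A) : ballots n A :=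
  [ffun k => if k == i then c else b k].

(** Off voter [i] the two profiles agree. Crossing the two ballots of [i] over to opposite sides
    avoids truncated subtraction. *)
Lemma score_update b (i : 'I_n) (c d : option A) :
  score (update b i c) d + (b i == d) =
  score b d + (c == d).
Proof.
have scoreD1 (f : ballots n A) : score f d = (f i == d) + #|[set k | f k == d] :\ i|.
  by rewrite /score (cardsD1 i) inE.
rewrite !scoreD1 ffunE eqxx.
have -> : [set k | update b i c k == d] :\ i =
          [set k | b k == d] :\ i.
  by apply/setP => k; rewrite !inE ffunE; case: eqP.
lia.
Qed.

Lemma score_vector_update b (i : 'I_n) (c : option A) :
  add_vote (sub_vote (score_vector b) (b i)) c =
  score_vector (update b i c).
Proof.
(* Truncation in [sub_vote] loses nothing: the ballot of [i] is itself counted in the score it is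
   removed from. *)
apply/ffunP => x; rewrite !ffunE !(eq_sym (Some x)) addnBAC; last first.
  by rewrite /score (cardsD1 i) inE leq_addr.
by rewrite -(score_update b i) addnK.
Qed.

Lemma mem_possible_winners sigma (s : scores A) t (x : A) :
  (Some x \in possible_winners sigma s t) = (sigma <= s x + t).
Proof.
apply/imsetP/idP => [[y]|h]; first by rewrite inE => h [->]; lia.
by exists x => //; rewrite inE; lia.
Qed.

Lemma mem_iterative_majority sigma (s : scores A) t (x : A) :
  (Some x \in iterative_majority sigma s t) = (sigma <= s x + t).
Proof.
rewrite /iterative_majority -mem_possible_winners.
by case: eqP => // ->; rewrite !inE.
Qed.

(** Whether or not [x] is possible, the outcome set is a singleton, [x] or the default, so the
    process stops. *)
Lemma iterative_majority_single sigma (s : scores A) t (x : A) :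
  (forall y : A, y != x -> s y + t < sigma) ->
  #|iterative_majority sigma s t| = 1.
Proof.
move=> others; rewrite /iterative_majority; case: ifP => [_|/set0Pn[c cW]].
  by rewrite cards1.
suff -> : possible_winners sigma s t = [set Some x] by rewrite cards1.
have sub d : d \in possible_winners sigma s t -> d = Some x.
  case: d => [y|/imsetP[]//]; rewrite mem_possible_winners.
  by have [-> //|/others] := eqVneq y x; lia.
apply/setP => d; rewrite inE; apply/idP/eqP => [/sub //|->].
by rewrite -(sub _ cW).
Qed.

End Scores.

Lemma bigmin_leq (I : finType) (P : {set I}) (F : I -> nat) m k :
  k \in P -> \big[minn/m]_(c in P) F c <= F k.
Proof.
move=> kP; have: k \in index_enum I by rewrite mem_index_enum.
elim: (index_enum I) => // c s IH; rewrite inE big_cons => /predU1P[<-|/IH le_s].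
  by rewrite kP geq_min leqnn.
by case: ifP => // _; rewrite geq_min le_s orbT.
Qed.

Lemma leq_bigmin (I : finType) (P : {set I}) (F : I -> nat) m l :
  l <= m -> (forall k, k \in P -> l <= F k) -> l <= \big[minn/m]_(c in P) F c.
Proof.
by move=> lm lF; elim/big_ind: _ => // x y lx ly; rewrite leq_min lx.
Qed.

(** * Ballot dynamics along a run *)

Section Runs.

Variables (R : realType) (n : nat) (A : finType) (sigma tau : nat).
Variables (a : 'I_n -> rel (option A)) (u : 'I_n -> utility R A).
Hypothesis ha : forall i, strict_linear_order (a i).
Hypothesis hu : (forall i, lazy_consistent n sigma tau (a i) (u i)) \/
                (forall i, proactive_consistent n sigma tau (a i) (u i)).

Implicit Type b : ballots n A.
Local Notation truth := (truthful a).
Local Notation run := (run sigma a u).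

(** Her favourite [x] is already the outcome she gets, and no outcome is better. Possibility is
    required at [t], not [t.+1], because best responses look one step ahead. *)
Lemma truthful_stays b (i : 'I_n) t (x : A) :
  t < tau -> b i = Some x -> truth i = Some x -> sigma <= score b (Some x) + t ->
  i \notin movers a u t.+1 b.
Proof.
move=> tt bi ti xW; rewrite inE negbK /best_response.
suff -> : b i \in maximizers u t.+1 b i by [].
rewrite inE; apply/forallP => c; rewrite subn1 /= !score_vector_update.
have -> : update b i (b i) = b.
  by apply/ffunP => k; rewrite ffunE; case: eqP => // ->.
set b' := (X in score_vector X); rewrite leNgt; apply/negP => lt_u.
have {}ti : top (a i) setT = Some x by rewrite -ti ffunE.
have topE : top (a i) (iterative_majority sigma (score_vector b) t) = Some x.
  by rewrite -ti top_eq_setT // ti mem_iterative_majority ffunE.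
have top_best d : a i d (Some x) -> False.
  have [-> |dx] := eqVneq d (Some x); first by have [-> _] := ha i.
  apply: order_asym => //; rewrite -ti; apply: top_setT_max => //.
  by rewrite ti.
have score_b' : score b' (Some x) <= score b (Some x).
  by have := score_update b i c (Some x); rewrite bi eqxx -/b'; lia.
have [hlazy|hpro] := hu.
  by have /(hlazy i _ _ _ (ltnW tt)) := lt_u; rewrite topE => /top_best.
(* A proactive gain with the same winner [x] would need a higher score for [x], but leaving [x]
   cannot raise it. *)
have /(hpro i _ _ _ (ltnW tt)) := lt_u; rewrite topE => -[/top_best //|].
by case=> y [_ [<-]]; rewrite !ffunE ltnNge score_b'.
Qed.

Lemma score_transition t b b' c :
  transition a u t b b' -> score b' c <= score b c + 1.
Proof.
rewrite /transition; case: ifP => _ => [->|[j _ ->]]; first by rewrite leq_addr.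
rewrite -/(update b j (best_response a u t b j)).
by have := score_update b j (best_response a u t b j) c; lia.
Qed.

(** Going back one step loses at most one vote and gains one unit of time, so possibility propagates
    backwards from the stopping time. *)
Lemma run_winner_possible t b (w : A) :
  run t b (Some w) -> sigma <= score b (Some w) + t.
Proof.
move E: (Some w) => o r; elim: r E => {t b o} [t b o Fo E | t b b' o _ tr _ IH /IH].
  rewrite -E in Fo *.
  by have := set11 (Some w); rewrite -Fo mem_iterative_majority ffunE.
by have := score_transition o tr; lia.
Qed.


(** Induction along the run needs an arbitrary [b]; the invariant is that every truthful supporter
    of [x] still votes for [x]. *)
Lemma majority_wins (x : A) t b (w : A) :
  n < 2 * score truth (Some x) -> t <= tau ->
  (forall i : 'I_n, truth i = Some x -> b i = Some x) -> run t b (Some w) -> w = x.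
Proof.
move=> maj tt inv r.
have trailing b0 (y : A) : (forall i : 'I_n, truth i = Some x -> b0 i = Some x) -> y != x ->
    score b0 (Some y) < score b0 (Some x).
  move=> inv0 yx; have := @score_disjoint _ _ b0 (Some y) (Some x) yx.
  suff : score truth (Some x) <= score b0 (Some x) by lia.
  by apply/subset_leq_card/subsetP => i; rewrite !inE => /eqP/inv0 ->.
move E: (Some w) r => o r.
elim: r E tt inv => {t b o} [t b o Fo | t b b' o Fn tr _ IH] Eo tt inv.
  (* If another [w] won, [x] would be possible too, having more votes, and the outcome set would not
     be a singleton. *)
  apply/eqP/negPn/negP => wx.
  have : Some w \in iterative_majority sigma (score_vector b) t by rewrite Fo Eo set11.
  rewrite mem_iterative_majority ffunE => wW.
  have : Some x \in iterative_majority sigma (score_vector b) t.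
    by rewrite mem_iterative_majority ffunE; have := trailing _ _ inv wx; lia.
  by rewrite Fo -Eo inE => /eqP[xw]; rewrite xw eqxx in wx.
apply: (IH Eo (ltnW tt)) => i ti; have bi := inv i ti.
suff stays : i \notin movers a u t.+1 b.
  move: tr; rewrite /transition; case: ifP => _ => [-> //|[j jm ->]].
  by rewrite ffunE; case: eqP => // ij; rewrite ij jm in stays.
apply: truthful_stays (bi) (ti) _ => //; rewrite leqNgt; apply/negP => lt_x.
(* Trailing [x] by at least one vote offsets the extra unit of time: if [x] is impossible at [t],
   every rival is impossible at [t.+1]. *)
case/negP: Fn; apply/eqP/(@iterative_majority_single _ _ _ _ x) => y yx.
by rewrite !ffunE; have := trailing _ _ inv yx; lia.
Qed.

Lemma winner_has_truthful_vote t (w : A) :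
  2 <= n -> 0 < #|A| -> (forall i (c : A), a i (Some c) None) ->
  sigma <= t -> t <= tau -> run t truth (Some w) -> 0 < score truth (Some w).
Proof.
move=> n2 A0 hdef st tt.
have vote i x : truth i = Some x -> 0 < score truth (Some x).
  by move=> ti; apply/card_gt0P; exists i; rewrite inE ti.
have truthE i : exists x, truth i = Some x.
  by have [x xE] := top_setT_valid (ha i) A0 (hdef i); exists x; rewrite ffunE.
move Eb: truth => b; move Eo: (Some w) => o r.
elim: r Eb Eo st tt => {t b o} [t b o Fo | t b b' o Fn tr r IH] Eb Eo st tt.
  (* With [t] at least [sigma] every valid alternative is possible, so a singleton outcome is the
     favourite of any voter, here the first. *)
  have [x ix] := truthE (Ordinal (ltnW n2)); have := vote _ _ ix; rewrite -Eb -Eo in Fo *.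
  have : Some x \in iterative_majority sigma (score_vector truth) t.
    by rewrite mem_iterative_majority; lia.
  by rewrite Fo inE => /eqP ->.
have Eb' : truth = b'.
  suff m0 : movers a u t.+1 b = set0 by move: tr; rewrite /transition m0 eqxx Eb.
  apply/setP => i; rewrite [RHS]inE; apply/negbTE; have [x ix] := truthE i.
  have bi := ix; rewrite Eb in bi.
  (* Her own vote supplies the one unit missing when [t.+1 = sigma]. *)
  by apply: truthful_stays (bi) (ix) _ => //; have := vote _ _ ix; rewrite Eb; lia.
have [st'|ts] := leqP sigma t; first by rewrite -Eb Eb'; apply: IH => //; lia.
rewrite -Eo -Eb' in r.
by have := run_winner_possible r; rewrite -Eb -Eo; lia.
Qed.

Lemma PoA_le k :
  (forall w, run tau truth (Some w) -> \max_(c : option A) score truth c <= score truth (Some w) + k) ->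
  (PoA sigma a u tau <= k%:Z)%R.
Proof.
move=> h; rewrite /PoA.
have : \max_(c : option A) score truth c - k <=
    \big[minn/n]_(c in winners sigma a u tau) score truth (Some c).
  (* The initial value [n] of the minimum is harmless, as no score exceeds it. *)
  apply: leq_bigmin => [|w]; first apply: leq_trans (leq_subr _ _) _.
    by apply/bigmax_leqP => c _; exact: score_le.
  by rewrite inE => /asboolP/h; lia.
lia.
Qed.

Lemma PoA_ge0 : winners sigma a u tau != set0 -> (0 <= PoA sigma a u tau)%R.
Proof.
case/set0Pn => w wW; rewrite /PoA.
have := bigmin_leq (fun c => score truth (Some c)) n wW.
have : score truth (Some w) <= \max_(c : option A) score truth c by exact: bigop.leq_bigmax.
lia.
Qed.

End Runs.


Theorem theorem3 (R : realType) (n : nat) (A : finType) (sigma tau : nat)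
    (a : 'I_n -> rel (option A)) (u : 'I_n -> utility R A)
    (hn : 2 <= n)
    (hA : 1 <= #|A|)
    (hsigma : n < 2 * sigma)
    (hsigman : sigma <= n)
    (ha : forall i, strict_linear_order (a i))
    (hdefault : forall (i : 'I_n) (c : A), a i (Some c) None)
    (hu : (forall i, lazy_consistent n sigma tau (a i) (u i)) \/
          (forall i, proactive_consistent n sigma tau (a i) (u i)))
    (hPoA : winners sigma a u tau != set0) :
  [/\ tau <= sigma - n./2 -> PoA sigma a u tau = 0%R,
      sigma - n./2 < tau < sigma ->
        (PoA sigma a u tau <= (n./2)%:Z + tau%:Z - sigma%:Z)%R
    & sigma <= tau -> (PoA sigma a u tau <= (n./2)%:Z - 1)%R].
Proof.
set M := \max_(c : option A) score (truthful a) c.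
have possible w : run sigma a u tau (truthful a) (Some w) ->
    sigma <= score (truthful a) (Some w) + tau by exact: run_winner_possible.
have max_cases w : run sigma a u tau (truthful a) (Some w) ->
    M <= n./2 \/ M = score (truthful a) (Some w).
  move=> rw; have [|half_M] := leqP M n./2; first by left.
  have [|c Mc] := bigop.eq_bigmax (score (truthful a)).
    by rewrite card_option.
  have {}Mc : M = score (truthful a) c := Mc.
  case: c Mc => [x|] Mx.
    by right; rewrite (majority_wins ha hu _ (leqnn _) _ rw (x := x)) //; lia.
  (* The default cannot attain a maximum above [n./2], since no favourite is the default. *)
  have : score (truthful a) None = 0.
    apply/eqP; rewrite cards_eq0; apply/eqP/setP => i; rewrite !inE ffunE.
    by have [x ->] := top_setT_valid (ha i) hA (hdefault i).
  lia.
have bound := @PoA_le R n A sigma tau a u.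
split=> [t_le|/andP[lt_t t_lt]|le_t].
- apply/eqP; rewrite eq_le PoA_ge0 // andbT.
  by apply: (bound 0) => w rw; have := possible w rw; have := max_cases w rw; lia.
(* The lower bound on [tau] makes the natural-number subtraction exact; in the last case [2 <= n]
   does. *)
- have -> : ((n./2)%:Z + tau%:Z - sigma%:Z = (n./2 + tau - sigma)%N%:Z)%R by lia.
  by apply: bound => w rw; have := possible w rw; have := max_cases w rw; lia.
- have -> : ((n./2)%:Z - 1 = (n./2 - 1)%N%:Z)%R by lia.
  apply: bound => w rw.
  have := winner_has_truthful_vote ha hu hn hA hdefault le_t (leqnn _) rw.
  by have := max_cases w rw; lia.
Qed.
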